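(* For all integers $n\geq 1$, $$\mathcal{B}_{n;q}(x)=\sum_{k=0}^n\binom{n}{k}_{c;q}\mathcal{B}_{n-k;q}\,\mathcal{E}_{k;q}(x)+\frac{1}{2}\,\frac{c_{n;q}}{c_{n-1;q}}\,\mathcal{E}_{n-1;q}(x).$$
   Context: Fix a complex parameter $q\neq 1$ such that $jq-(j-1)\neq 0$ for all integers $j\ge 1$. Let $Q_0(q)=1$, $Q_n(q)=\prod_{j=1}^{n}(jq-(j-1))$, and $c_{0;q}=1$, $c_{n;q}=n!/Q_{n-1}(q)$ for $n\ge 1$. The Carlitz-Tsallis deformed exponential is $e_q(x)=(1+(1-q)x)^{1/(1-q)}=\sum_{n\ge 0}x^n/c_{n;q}$ (as a formal power series). Put $\binom{n}{k}_{c;q}=\frac{c_{n;q}}{c_{k;q}c_{n-k;q}}$ for $0\le k\le n$. The degenerate Bernoulli polynomials $\mathcal{B}_{n;q}(x)$ and degenerate Euler polynomials $\mathcal{E}_{n;q}(x)$ are defined by the formal power series identities in $t$ $$\frac{t}{e_q(t)-1}e_q(xt)=\sum_{n\ge0}\mathcal{B}_{n;q}(x)\frac{t^n}{c_{n;q}},\qquad \frac{2}{e_q(t)+1}e_q(xt)=\sum_{n\ge0}\mathcal{E}_{n;q}(x)\frac{t^n}{c_{n;q}},$$ and the degenerate Bernoulli numbers are $\mathcal{B}_{n;q}=\mathcal{B}_{n;q}(0)$. *)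

(* Defs.v *)
From HB Require Import structures.
From mathcomp Require Import all_boot all_order all_algebra.
From mathcomp Require Import reals complex ring.

Set Implicit Arguments.
Unset Strict Implicit.
Unset Printing Implicit Defensive.

Import Order.TTheory GRing.Theory Num.Theory.
Local Open Scope ring_scope.

(* A formal power series sum_n a_n t^n over A is its coefficient sequence
   a : nat -> A. *)
Definition fps (A : Type) := nat -> A.

Definition fps_const (A : nzRingType) (a : A) : fps A :=
  fun n => if n == 0%N then a else 0.

Definition fps_t (A : nzRingType) : fps A := fun n => (n == 1%N)%:R.

Definition fps_add (A : nzRingType) (a b : fps A) : fps A :=
  fun n => a n + b n.

Definition fps_sub (A : nzRingType) (a b : fps A) : fps A :=
  fun n => a n - b n.

Definition fps_mul (A : nzRingType) (a b : fps A) : fps A :=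
  fun n => \sum_(i < n.+1) a i * b (n - i)%N.

(* Division by t, for a series with zero constant coefficient. *)
Definition fps_shift (A : Type) (a : fps A) : fps A := fun n => a n.+1.

(* The first n coefficients of the inverse of a, obtained by solving
   a * b = 1 for b_0, b_1, ... successively. *)
Fixpoint fps_inv_seq (F : fieldType) (a : fps F) (n : nat) : seq F :=
  if n is m.+1 then
    let s := fps_inv_seq a m in
    rcons s ((a 0%N)^-1 * ((m == 0%N)%:R - \sum_(i < m) s`_i * a (m - i)%N))
  else [::].

(* The multiplicative inverse, meaningful when a 0 != 0. *)
Definition fps_inv (F : fieldType) (a : fps F) : fps F :=
  fun n => (fps_inv_seq a n.+1)`_n.

(* The inclusion of F[[t]] in F[x][[t]]. *)
Definition fps_polyC (F : fieldType) (a : fps F) : fps {poly F} :=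
  fun n => (a n)%:P.

(* The substitution a(t) |-> a(x t), from F[[t]] to F[x][[t]]. *)
Definition fps_xt (F : fieldType) (a : fps F) : fps {poly F} :=
  fun n => a n *: 'X^n.

(* Newton's binomial series (1 + a t)^s. *)
Definition fps_binomial (F : fieldType) (a s : F) : fps F :=
  fun n => (\prod_(j < n) (s - j%:R)) / (n`!)%:R * a ^+ n.

Section Degenerate.
Variables (F : fieldType) (q : F).

Definition Qpoly (n : nat) : F :=
  \prod_(1 <= j < n.+1) (j%:R * q - (j%:R - 1)).

Definition cfact (n : nat) : F :=
  if n is m.+1 then (n`!)%:R / Qpoly m else 1.

Definition cbinom (n k : nat) : F := cfact n / (cfact k * cfact (n - k)).

(* e_q(t) = (1 + (1 - q) t)^(1 / (1 - q)); lemma dexpE below gives its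
   expansion sum_n t^n / c_n. *)
Definition dexp : fps F := fps_binomial (1 - q) (1 - q)^-1.

(* t / (e_q(t) - 1): since e_q(t) - 1 has no constant term, this is the
   inverse of (e_q(t) - 1) / t; see bernoulli_quotP. *)
Definition bernoulli_quot : fps F :=
  fps_inv (fps_shift (fps_sub dexp (fps_const 1))).

(* 2 / (e_q(t) + 1) *)
Definition euler_quot : fps F :=
  fps_mul (fps_const 2) (fps_inv (fps_add dexp (fps_const 1))).

(* The defining identity sum_n B_n(x) t^n / c_n = t / (e_q(t) - 1) * e_q(x t),
   solved for B_n(x); see dbernoulliP. *)
Definition dbernoulli (n : nat) : {poly F} :=
  cfact n *: fps_mul (fps_polyC bernoulli_quot) (fps_xt dexp) n.

Definition deuler (n : nat) : {poly F} :=
  cfact n *: fps_mul (fps_polyC euler_quot) (fps_xt dexp) n.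

Definition dbernoulli_num (n : nat) : F := (dbernoulli n).[0].

End Degenerate.

Definition admissible (F : fieldType) (q : F) : Prop :=
  q != 1 /\ forall j : nat, (1 <= j)%N -> j%:R * q - (j%:R - 1) != 0.

Lemma size_fps_inv_seq (F : fieldType) (a : fps F) n :
  size (fps_inv_seq a n) = n.
Proof. by elim: n => //= n IH; rewrite size_rcons IH. Qed.

Lemma nth_fps_inv_seq (F : fieldType) (a : fps F) n i :
  (i < n)%N -> (fps_inv_seq a n)`_i = fps_inv a i.
Proof.
elim: n => // n IH; rewrite ltnS leq_eqVlt => /orP[/eqP-> //|lt_in].
by rewrite /= nth_rcons size_fps_inv_seq lt_in IH.
Qed.

Lemma fps_invE (F : fieldType) (a : fps F) n :
  fps_inv a n =
    (a 0%N)^-1 * ((n == 0%N)%:R - \sum_(i < n) fps_inv a i * a (n - i)%N).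
Proof.
rewrite {1}/fps_inv /= nth_rcons size_fps_inv_seq ltnn eqxx.
by congr (_ * (_ - _)); apply: eq_bigr => i _; rewrite nth_fps_inv_seq.
Qed.

Lemma fps_mulVr (F : fieldType) (a : fps F) : a 0%N != 0 ->
  fps_mul (fps_inv a) a =1 fps_const 1.
Proof.
move=> a0 n; rewrite /fps_mul big_ord_recr /= subnn [fps_inv a n]fps_invE.
rewrite mulrC mulrA mulfV // mul1r addrC subrK /fps_const.
by case: (n == 0%N).
Qed.

Section Checks.
Variables (F : numFieldType) (q : F).
Hypothesis Hq : admissible q.

Lemma cfact_neq0 n : cfact q n != 0.
Proof.
case: n => [|n] /=; first exact: oner_neq0.
rewrite mulf_neq0 ?invr_eq0 ?pnatr_eq0 -?lt0n ?fact_gt0 //.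
rewrite /Qpoly big_nat prodf_seq_neq0; apply/allP => j _.
by apply/implyP => /andP[j_gt0 _]; apply: Hq.2.
Qed.

Lemma dexpE n : dexp q n = (cfact q n)^-1.
Proof.
have q1 : 1 - q != 0 by rewrite subr_eq0 eq_sym Hq.1.
case: n => [|n]; first by
  rewrite /dexp /fps_binomial big_ord0 fact0 !divr1 mul1r invr1.
rewrite /dexp /fps_binomial /cfact invf_div mulrAC; congr (_ / _).
rewrite -[X in _ ^+ X]card_ord -prodr_const -big_split big_ord_recl /=.
rewrite subr0 mulVf // mul1r /Qpoly big_add1 big_mkord; apply: eq_bigr => i _.
by rewrite /= /bump leq0n add1n mulrBl mulVf //; ring.
Qed.

Lemma bernoulli_quotP :
  fps_mul (bernoulli_quot q) (fps_sub (dexp q) (fps_const 1)) =1 fps_t F.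
Proof.
set s := fps_sub _ _.
have s0 : s 0%N = 0 by rewrite /s /fps_sub dexpE /fps_const /= invr1 subrr.
have s1 : fps_shift s 0%N != 0.
  rewrite /fps_shift /s /fps_sub dexpE /fps_const /cfact /Qpoly big_nil divr1.
  by rewrite invr1 subr0 oner_neq0.
case=> [|n]; first by rewrite /fps_mul big_ord_recl big_ord0 s0 mulr0 addr0.
rewrite /fps_mul big_ord_recr /= subnn s0 mulr0 addr0 /fps_t eqSS.
transitivity (fps_const (1 : F) n); last by rewrite /fps_const; case: (n == _).
rewrite -(fps_mulVr s1); apply: eq_bigr => i _.
by rewrite /fps_shift -subSn // -ltnS.
Qed.

Lemma euler_quotP :
  fps_mul (euler_quot q) (fps_add (dexp q) (fps_const 1)) =1 fps_const 2.
Proof.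
have E i : euler_quot q i = 2 * fps_inv (fps_add (dexp q) (fps_const 1)) i.
  rewrite /euler_quot /fps_mul big_ord_recl subn0 big1 ?addr0 // => j _.
  by rewrite /fps_const /= mul0r.
have a0 : fps_add (dexp q) (fps_const 1) 0%N != 0.
  by rewrite /fps_add dexpE /fps_const /= invr1 -[1 + 1]/(2%:R) pnatr_eq0.
move=> n; transitivity (2 * fps_const (1 : F) n); last first.
  by rewrite /fps_const; case: (n == 0%N); rewrite ?mulr1 ?mulr0.
rewrite -(fps_mulVr a0) /fps_mul mulr_sumr.
by apply: eq_bigr => i _; rewrite E mulrA.
Qed.

Lemma dbernoulliP :
  fps_mul (fps_polyC (bernoulli_quot q)) (fps_xt (dexp q))
    =1 (fun n => (cfact q n)^-1 *: dbernoulli q n).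
Proof. by move=> n; rewrite scalerA mulVf ?cfact_neq0 // scale1r. Qed.

Lemma deulerP :
  fps_mul (fps_polyC (euler_quot q)) (fps_xt (dexp q))
    =1 (fun n => (cfact q n)^-1 *: deuler q n).
Proof. by move=> n; rewrite scalerA mulVf ?cfact_neq0 // scale1r. Qed.

End Checks.

(* Main.v *)
Require Import Defs.
From mathcomp Require Import all_boot all_order all_algebra.
From mathcomp Require Import reals complex.
From mathcomp Require Import boolp.

Set Implicit Arguments.
Unset Strict Implicit.
Unset Printing Implicit Defensive.

Import GRing.Theory.
Local Open Scope ring_scope.

(** Write [b(t) = t / (e_q(t) - 1)] and [g(t) = 2 / (e_q(t) + 1)] for the two
    quotients that generate the Bernoulli and the Euler polynomials. Since
    [t = b (e_q - 1)],
      [b + t/2 = b + b (e_q - 1) / 2 = b (e_q + 1) / 2],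
    and multiplying by [g] gives [(b + t/2) g = b]
    (lemma [bernoulli_quot_euler_quot]). Multiplying further by [e_q(x t)]
    turns [b] into the generating series of the Bernoulli polynomials and [g]
    into that of the Euler polynomials. The coefficient of [t^n] is then the
    theorem, up to the normalization by [c_n]: the product by [b] is the
    convolution with the Bernoulli numbers, because [e_q(x t) = 1] at [x = 0],
    and the product by [t/2] is the shifted term of index [n - 1].

    These manipulations use that power series form a commutative ring. A
    coefficient of a product only depends on finitely many coefficients of the
    factors, so commutativity and associativity are read off polynomial
    truncations ([fps_mul_coefM]). *)

(** * The ring laws of formal power series *)

Section FpsRing.
Variable A : comNzRingType.
Implicit Types a b c : fps A.

(** The polynomials need only agree with the series up to [N], so that this
    applies as well to a product of truncations, which is not itself the
    truncation of the product. *)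
Lemma fps_mul_coefM (N : nat) (a b : fps A) (p r : {poly A}) :
    (forall i, (i <= N)%N -> p`_i = a i) ->
    (forall i, (i <= N)%N -> r`_i = b i) ->
  forall i, (i <= N)%N -> (p * r)`_i = fps_mul a b i.
Proof.
move=> pa rb i le_iN; rewrite coefM; apply: eq_bigr => j _.
rewrite pa ?rb //; last by apply: leq_trans le_iN; rewrite -ltnS.
by apply: leq_trans le_iN; apply: leq_subr.
Qed.

Let trunc (N : nat) (a : fps A) : {poly A} := \poly_(i < N.+1) a i.

Let coef_trunc N a i : (i <= N)%N -> (trunc N a)`_i = a i.
Proof. by move=> le_iN; rewrite coef_poly ltnS le_iN. Qed.

Lemma fps_mulC a b : fps_mul a b = fps_mul b a.
Proof.
apply: funext => n; have cT := @coef_trunc n.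
rewrite -(fps_mul_coefM (cT a) (cT b) (leqnn n)) mulrC.
exact: (fps_mul_coefM (cT b) (cT a)).
Qed.

Lemma fps_mulA a b c : fps_mul a (fps_mul b c) = fps_mul (fps_mul a b) c.
Proof.
apply: funext => n; have cT := @coef_trunc n.
have cM x y := fps_mul_coefM (cT x) (cT y).
rewrite -(fps_mul_coefM (cT a) (cM b c) (leqnn n)) mulrA.
exact: (fps_mul_coefM (cM a b) (cT c)).
Qed.

Lemma fps_mulDl a b c :
  fps_mul (fps_add a b) c = fps_add (fps_mul a c) (fps_mul b c).
Proof.
apply: funext => n; rewrite /fps_add /fps_mul -big_split /=.
by apply: eq_bigr => i _; rewrite mulrDl.
Qed.

Lemma fps_mul_constl (u : A) a n : fps_mul (fps_const u) a n = u * a n.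
Proof.
rewrite /fps_mul big_ord_recl subn0 big1 ?addr0 // => j _.
by rewrite /fps_const /= mul0r.
Qed.

Lemma fps_mul_tl a n : fps_mul (@fps_t A) a n.+1 = a n.
Proof.
rewrite /fps_mul !big_ord_recl big1 => [|j _]; last by rewrite /fps_t /= mul0r.
by rewrite /fps_t /= /bump /= mul0r mul1r add0r addr0 subSS subn0.
Qed.

End FpsRing.

(** * Constant polynomial coefficients *)

Section FpsPolyC.
Variable F : fieldType.
Implicit Types a b : fps F.

Lemma fps_polyCM a b :
  fps_polyC (fps_mul a b) = fps_mul (fps_polyC a) (fps_polyC b).
Proof.
apply: funext => n; rewrite /fps_polyC /fps_mul rmorph_sum /=.
by apply: eq_bigr => i _; rewrite polyCM.
Qed.

Lemma fps_polyCD a b :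
  fps_polyC (fps_add a b) = fps_add (fps_polyC a) (fps_polyC b).
Proof. by apply: funext => n; rewrite /fps_polyC /fps_add polyCD. Qed.

Lemma fps_polyC_const (u : F) : fps_polyC (fps_const u) = fps_const u%:P.
Proof. by apply: funext => -[|n]. Qed.

Lemma fps_polyC_t : fps_polyC (fps_t F) = @fps_t {poly F}.
Proof. by apply: funext => n; rewrite /fps_polyC /fps_t polyC_natr. Qed.

End FpsPolyC.

(** * The Bernoulli and Euler quotients *)

Section Degenerate.
Variables (F : numFieldType) (q : F).
Hypothesis Hq : admissible q.

Let half_t : fps F := fps_mul (fps_const 2^-1) (fps_t F).

Let two_neq0 : (2 : F) != 0.
Proof. by rewrite Num.Theory.pnatr_eq0. Qed.

(** Substitute [t = b (e_q - 1)]: adding [b = 2 b / 2] turns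
    [b (e_q - 1) / 2] into [b (e_q + 1) / 2]. *)
Lemma bernoulli_quotD_half_t :
  fps_add (bernoulli_quot q) half_t =
  fps_mul (fps_mul (fps_const 2^-1) (bernoulli_quot q))
          (fps_add (dexp q) (fps_const 1)).
Proof.
have -> : fps_add (dexp q) (fps_const 1) =
          fps_add (fps_sub (dexp q) (fps_const 1)) (fps_const 2).
  apply: funext => n; rewrite /fps_add /fps_sub /fps_const.
  case: (n == 0%N); last by rewrite subr0.
  by rewrite -[2]/(1 + 1) addrA subrK.
rewrite fps_mulC fps_mulDl ![fps_mul _ (fps_mul _ _)]fps_mulC -fps_mulA.
rewrite (funext (bernoulli_quotP Hq)) [fps_mul _ (fps_const 2)]fps_mulC.
apply: funext => n; rewrite /fps_add /half_t !fps_mul_constl.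
by rewrite mulVKf // addrC.
Qed.

Lemma bernoulli_quot_euler_quot :
  bernoulli_quot q =
  fps_mul (fps_add (bernoulli_quot q) half_t) (euler_quot q).
Proof.
rewrite bernoulli_quotD_half_t -fps_mulA [fps_mul (fps_add _ _) _]fps_mulC.
rewrite (funext (euler_quotP Hq)) fps_mulC.
by apply: funext => n; rewrite !fps_mul_constl mulVKf.
Qed.

(** At [x = 0] the series [e_q(x t)] reduces to its constant term [1]. *)
Lemma dbernoulli_numE n :
  dbernoulli_num q n = cfact q n * bernoulli_quot q n.
Proof.
rewrite /dbernoulli_num /dbernoulli hornerZ /fps_mul big_ord_recr /= subnn.
rewrite hornerD horner_sum big1 => [|i _].
  by rewrite add0r /fps_xt dexpE //= invr1 scale1r expr0 mulr1 hornerC.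
by rewrite hornerM /fps_xt hornerZ hornerXn expr0n subn_eq0 leqNgt ltn_ord !mulr0.
Qed.

Lemma dbernoulli_deuler n : (1 <= n)%N ->
  dbernoulli q n =
    \sum_(k < n.+1)
      (cbinom q n k * dbernoulli_num q (n - k)%N) *: deuler q k
    + (2^-1 * (cfact q n / cfact q n.-1)) *: deuler q n.-1.
Proof.
case: n => // n _; rewrite {1}/dbernoulli {1}bernoulli_quot_euler_quot.
rewrite fps_polyCM fps_polyCD fps_polyCM fps_polyC_const fps_polyC_t.
rewrite -fps_mulA fps_mulDl -fps_mulA (funext (deulerP Hq)) /fps_add.
rewrite fps_mul_constl fps_mul_tl scalerDr; congr (_ + _).
  (* Reversing the convolution makes its index that of the Euler polynomial. *)
  rewrite fps_mulC /fps_mul scaler_sumr; apply: eq_bigr => k _.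
  rewrite dbernoulli_numE /fps_polyC mulrC mul_polyC /cbinom invfM.
  move: (deuler q k) (cfact q n.+1) => e c; rewrite !scalerA; congr (_ *: _).
  by rewrite -!mulrA mulKf ?cfact_neq0 // [_^-1 * _]mulrC.
rewrite mul_polyC; move: (deuler q n) (cfact q n.+1) => e c.
by rewrite !scalerA mulrCA mulrA.
Qed.

End Degenerate.

Theorem theorem6p5 (R : realType) (q : R[i]) (hq : admissible q)
    (n : nat) (hn : (1 <= n)%N) :
  dbernoulli q n =
    \sum_(k < n.+1)
      (cbinom q n k * dbernoulli_num q (n - k)%N) *: deuler q k
    + (2^-1 * (cfact q n / cfact q n.-1)) *: deuler q n.-1.
Proof. exact: dbernoulli_deuler. Qed.
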